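(* Let $L_n^*=\min_{\beta\in[0,1]^n}L_n(\beta)$ for $n\ge 1$. (a) Let $0<\rho<1$ and $n_0=\max\{k\in\mathbb N:\frac{1+\rho^{k+1}}{k+1}\le\rho\,\frac{1+\rho^k}{k}\}$. Then the minimum of $L_n(\beta)$ is attained with $\beta_i=\frac{i}{i+1}$ for $i\le n_0$ and $\beta_i=1$ for $i>n_0$ ($1\le i\le n$), so that $$L_n^*=\begin{cases}\frac{1+\rho^{n+1}}{n+1}&\text{if }n\le n_0,\\[1ex]\frac{1+\rho^{n_0+1}}{n_0+1}\,\rho^{n-n_0}&\text{if }n>n_0.\end{cases}$$ (b) Let $\rho>1$ and $n_0=\max\{k\in\mathbb N:\frac{1+\rho^{k+1}}{k+1}\le\frac{1+\rho^k}{k}\}$. For $n\le n_0$ the minimum of $L_n(\beta)$ is attained with $\beta_i=i/(i+1)$ for all $1\le i\le n$. For $n>n_0$ the optimal value is achieved by performing $n_0$ Halpern iterations with these same $\beta_i$'s and then halting the iteration by setting $x^n=x^{n-1}$; that is, $L_n^*=L_{n_0}\big(\tfrac12,\tfrac23,\dots,\tfrac{n_0}{n_0+1}\big)$. Consequently $$L_n^*=\begin{cases}\frac{1+\rho^{n+1}}{n+1}&\text{if }n\le n_0,\\[1ex]\frac{1+\rho^{n_0+1}}{n_0+1}&\text{if }n>n_0.\end{cases}$$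
   Context: $\mathbb N=\{0,1,2,\dots\}$; in the definitions of $n_0$ the case $k=0$ is regarded as satisfying the inequality (the right-hand side being $+\infty$). For $\beta=(\beta_1,\dots,\beta_n)\in[0,1]^n$ put $\mathcal B_i^n=\prod_{j=i}^n\beta_j$ for $i=1,\dots,n$, $\mathcal B_i^n=0$ for $i\le0$, $\mathcal B_i^n=1$ for $i>n$, and for $\rho>0$ $$L_n(\beta)=\sum_{i=0}^{n+1}\big|\mathcal B_{i+1}^n-2\mathcal B_i^n+\mathcal B_{i-1}^n\big|\,\rho^{\,n+1-i}.$$ For $n=0$ (empty $\beta$) this gives $L_0=1+\rho$. The quantity $L_n(\beta)$ arises as the tight residual bound $\|x^n-Tx^n\|\le\delta_0L_n(\beta)$ for the Halpern iterates $x^n=(1-\beta_n)x^0+\beta_nTx^{n-1}$ of an affine $\rho$-Lipschitz map $T:X\to X$ on a normed space having a fixed point $x^*$, where $\delta_0\ge\|x^0-x^*\|$. *)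

(* Defs.v *)
From mathcomp Require Import all_boot all_order all_algebra.
From mathcomp Require Import boolp classical_sets reals.

Set Implicit Arguments.
Unset Strict Implicit.
Unset Printing Implicit Defensive.

Import Order.TTheory GRing.Theory Num.Theory.
Local Open Scope ring_scope.
Local Open Scope classical_set_scope.

Definition is_max (d : Order.disp_t) (T : porderType d) (A : set T) (m : T) :
  Prop := A m /\ ubound A m.

Definition is_min (d : Order.disp_t) (T : porderType d) (A : set T) (m : T) :
  Prop := A m /\ lbound A m.

Section Halpern.
Variables (R : realType) (rho : R).

(* A vector beta = (beta_1, ..., beta_n) is a row vector: beta_j is the entry
   of index j - 1, so the entry of index j : 'I_n is beta_(j.+1). *)

(* B_i^n for every i : int. For i > n the product is empty, hence 1. *)
Definition Bprod (n : nat) (beta : 'rV[R]_n) (i : int) : R :=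
  if i <= 0 then 0 else \prod_(j < n | i <= (j.+1)%:Z) beta 0 j.

Definition L (n : nat) (beta : 'rV[R]_n) : R :=
  \sum_(i < n.+2)
    `| Bprod beta (i%:Z + 1) - 2 * Bprod beta i%:Z + Bprod beta (i%:Z - 1) |
      * rho ^+ (n.+1 - i).

Definition cube (n : nat) : set 'rV[R]_n :=
  [set beta | forall j, 0 <= beta 0 j <= 1].

Definition L_minimizer (n : nat) (beta : 'rV[R]_n) : Prop :=
  cube beta /\ forall beta' : 'rV[R]_n, cube beta' -> L beta <= L beta'.

(* v is the value L_n^* of the minimum; in particular that minimum exists. *)
Definition is_Lstar (n : nat) (v : R) : Prop :=
  is_min [set L beta | beta in @cube n] v.

Definition beta_opt (n m : nat) : 'rV[R]_n :=
  \row_(j < n) (if (j.+1 <= m)%N then (j.+1)%:R / (j.+2)%:R else 1).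

Definition beta_halpern (n : nat) : 'rV[R]_n :=
  \row_(j < n) ((j.+1)%:R / (j.+2)%:R).

(* Division by 0 gives 0 here, so the convention that k = 0 satisfies the
   inequality (whose right-hand side is then +oo) is an explicit disjunct. *)
Definition contraction_indices : set nat :=
  [set k | k = 0%N \/
     (1 + rho ^+ k.+1) / (k.+1)%:R <= rho * ((1 + rho ^+ k) / k%:R)].

Definition expansion_indices : set nat :=
  [set k | k = 0%N \/
     (1 + rho ^+ k.+1) / (k.+1)%:R <= (1 + rho ^+ k) / k%:R].

End Halpern.

(* Main.v *)
(* With B_i = Bprod beta i and d_i = B_i - B_(i-1), a sequence with total mass 1,
   L_n(beta) is the total variation of d (extended by 0) for the weights
   rho^(n+1-i). Summation by parts against a linear dual certificate
   y_i = a - c i with |y_i| <= rho^(n+1-i) gives L_n(beta) >= c, and equality is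
   reached when d is uniform on an interval of m+1 indices. The best length
   minimises (1 + sigma^k) / k, which is unimodal in k, with sigma = rho when
   rho > 1 (the interval ends at n+1) and sigma = 1/rho when rho < 1 (the
   interval starts at 1). *)
Require Import Defs.
From mathcomp Require Import all_boot all_order all_algebra.
From mathcomp Require Import boolp classical_sets reals.
From mathcomp Require Import zify ring lra.

Import Order.TTheory GRing.Theory Num.Theory.
Local Open Scope ring_scope.
Local Open Scope classical_set_scope.

(** * The products [Bprod] and their backward recursion *)

Lemma Bprod_le0 (R : realType) (n : nat) (beta : 'rV[R]_n) (i : int) :
  i <= 0 -> Bprod beta i = 0.
Proof. by rewrite /Bprod => ->. Qed.

Lemma Bprod_gt (R : realType) (n : nat) (beta : 'rV[R]_n) (i : nat) :
  (n < i)%N -> Bprod beta i%:Z = 1.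
Proof.
case: i => // i ni; rewrite /Bprod /=.
by rewrite big_pred0 // => j; have := ltn_ord j; lia.
Qed.

Lemma Bprod_rec (R : realType) (n : nat) (beta : 'rV[R]_n) (i : 'I_n) :
  Bprod beta i.+1%:Z = beta 0 i * Bprod beta i.+2%:Z.
Proof.
rewrite /Bprod /=.
rewrite (bigD1 i) ?lexx //=; congr (_ * _).
by apply: eq_bigl => j; rewrite -val_eqE /=; lia.
Qed.

(** Downward induction from index n+1, where both sequences equal 1; the value at 0 is a separate
    assumption because the recursion only reaches down to index 1. This identifies [Bprod] for
    explicit weights without evaluating products. *)
Lemma Bprod_unique (R : realType) (n : nat) (beta : 'rV[R]_n) (u : nat -> R) :
    u 0%N = 0 -> (forall i, (n < i)%N -> u i = 1) ->
    (forall i : 'I_n, u i.+1 = beta 0 i * u i.+2) ->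
  forall i : nat, Bprod beta i%:Z = u i.
Proof.
move=> u0 u1 urec i.
have [ni|] := ltnP n i; first by rewrite Bprod_gt ?u1.
move=> /subnKC; move: (n - i)%N => d; elim: d i => [|d IHd] [|i] ni;
  try by rewrite Bprod_le0.
- have lt_in : (i < n)%N by lia.
  rewrite (Bprod_rec _ _ _ (Ordinal lt_in)) (urec (Ordinal lt_in)) /=.
  by rewrite Bprod_gt ?u1 //; lia.
- have lt_in : (i < n)%N by lia.
  rewrite (Bprod_rec _ _ _ (Ordinal lt_in)) (urec (Ordinal lt_in)) /=.
  by rewrite IHd //; lia.
Qed.

(* At i = 0 the truncated i.-1 stands for -1: both B_0 and B_(-1) are 0. *)
Lemma L_nat (R : realType) (rho : R) (n : nat) (beta : 'rV[R]_n) :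
  L rho beta = \sum_(i < n.+2)
    `|Bprod beta i.+1%:Z - 2 * Bprod beta i%:Z + Bprod beta i.-1%:Z|
      * rho ^+ (n.+1 - i).
Proof.
apply: eq_bigr => -[[|i] lt_i] _ /=.
  by rewrite add0r sub0r [Bprod beta (- 1)]Bprod_le0 // [Bprod beta 0]Bprod_le0.
have -> : i.+1%:Z + 1 = i.+2%:Z by lia.
by have -> : i.+1%:Z - 1 = i%:Z by lia.
Qed.

(** * Lower bounds on [L] from affine dual certificates *)

Lemma sum_linear_second_diff (R : realType) (b : nat -> R) (a c : R) (k : nat) :
  b 0%N = 0 ->
  \sum_(i < k.+1) (a - c * i%:R) * (b i.+1 - 2 * b i + b i.-1) =
    (a - c * k%:R) * (b k.+1 - b k) + c * b k.
Proof.
move=> b0; elim: k => [|k IHk]; first by rewrite big_ord1 /= b0; ring.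
by rewrite big_ord_recr /= IHk -[in RHS]natr1 -natr1; ring.
Qed.

(** Weak duality: summation by parts leaves only the upper boundary term, which is [c] because
    [Bprod] is 1 at n+1 and n+2, while termwise the weights dominate the certificate. *)
Lemma L_ge_certificate (R : realType) (rho : R) (n : nat) (beta : 'rV[R]_n)
    (a c : R) :
  (forall i, (i <= n.+1)%N -> `|a - c * i%:R| <= rho ^+ (n.+1 - i)) ->
  c <= L rho beta.
Proof.
move=> cert.
have <- : \sum_(i < n.+2) (a - c * i%:R) *
    (Bprod beta i.+1%:Z - 2 * Bprod beta i%:Z + Bprod beta i.-1%:Z) = c.
  rewrite (sum_linear_second_diff _ (fun i => Bprod beta i%:Z)).
    by rewrite !Bprod_gt // subrr mulr0 add0r mulr1.
  exact: Bprod_le0.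
rewrite L_nat; apply: ler_sum => i _; apply: le_trans (ler_norm _) _.
by rewrite normrM mulrC ler_wpM2l ?normr_ge0 ?cert // -ltnS.
Qed.

(** Taking [a] to be the weight at index 0 makes the certificate tight there. Its bound from above
    then follows from [0 <= c] and [rho <= 1]; the last hypothesis is the bound from below. *)
Lemma L_ge_contraction (R : realType) (rho c : R) (n : nat) (beta : 'rV[R]_n) :
  0 < rho <= 1 -> 0 <= c ->
  (forall i, (i <= n.+1)%N -> c * i%:R <= rho ^+ n.+1 + rho ^+ (n.+1 - i)) ->
  c <= L rho beta.
Proof.
move=> /andP[r0 r1] c0 cle; apply: (L_ge_certificate _ _ _ _ (rho ^+ n.+1)).
move=> i i_n; have := cle i i_n.
have ci0 : 0 <= c * i%:R by rewrite mulr_ge0.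
have : rho ^+ n.+1 <= rho ^+ (n.+1 - i).
  by rewrite ler_wiXn2l ?leq_subr // ltW.
by move=> ? ?; rewrite ler_norml; lra.
Qed.

(** Mirror image: [a] is chosen so that the certificate is -1 at n+1, tight with the opposite sign.
    With indices counted from the right end, the bound from below follows from [1 <= rho] and
    [0 <= c], and the last hypothesis is the bound from above. *)
Lemma L_ge_expansion (R : realType) (rho c : R) (n : nat) (beta : 'rV[R]_n) :
  1 <= rho -> 0 <= c ->
  (forall i, (i <= n.+1)%N -> c * i%:R <= 1 + rho ^+ i) ->
  c <= L rho beta.
Proof.
move=> r1 c0 cle.
apply: (L_ge_certificate _ _ _ _ (c * n.+1%:R - 1)) => i i_n.
have -> : c * n.+1%:R - 1 - c * i%:R = c * (n.+1 - i)%:R - 1.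
  by rewrite natrB //; ring.
have := cle _ (leq_subr i n.+1).
have : 0 <= c * (n.+1 - i)%:R by rewrite mulr_ge0.
have : 1 <= rho ^+ (n.+1 - i) by rewrite exprn_ege1.
by move=> ? ? ?; rewrite ler_norml; lra.
Qed.

(** * Profiles with uniform increments, where the bounds are attained *)

Definition ramp (R : realType) (s m i : nat) : R :=
  (minn (i - s) m.+1)%:R / m.+1%:R.

(* The weights beta_j = B_j / B_(j+1) for B = ramp s m; for j < s this is the
   junk value 0 / 0 = 0. *)
Definition beta_block (R : realType) (n s m : nat) : 'rV[R]_n :=
  \row_(j < n) ((minn (j.+1 - s) m.+1)%:R / (minn (j.+2 - s) m.+1)%:R).

Lemma beta_block_cube (R : realType) (n s m : nat) :
  cube (beta_block R n s m).
Proof.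
move=> j; rewrite mxE divr_ge0 ?ler0n //=.
have le_u : (minn (j.+1 - s) m.+1 <= minn (j.+2 - s) m.+1)%N by lia.
have [-> | u0] := posnP (minn (j.+2 - s) m.+1); first by rewrite invr0 mulr0.
by rewrite ler_pdivrMr ?ltr0n // mul1r ler_nat.
Qed.

Lemma Bprod_block (R : realType) (n s m i : nat) : (s + m <= n)%N ->
  Bprod (beta_block R n s m) i%:Z = ramp R s m i.
Proof.
move=> smn; apply: Bprod_unique => [|{}i ni|{}i]; rewrite /ramp ?mxE.
- by rewrite sub0n min0n mul0r.
- by rewrite (minn_idPr _) ?divff ?pnatr_eq0 //; lia.
- have [u0 | u0] := posnP (minn (i.+2 - s) m.+1).
    rewrite (_ : minn (i.+1 - s) m.+1 = 0)%N; last by lia.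
    by rewrite !mul0r.
  by rewrite mulrA divfK // pnatr_eq0 -lt0n.
Qed.

(** The slope jumps only at [s], by 1/(m+1), and at [s + m.+1], by the opposite amount. At [i = 0]
    the truncated predecessor is harmless, since the ramp continues by 0 to the left. *)
Lemma ramp_second_diff (R : realType) (s m i : nat) :
  `|ramp R s m i.+1 - 2 * ramp R s m i + ramp R s m i.-1| =
    ((i == s)%:R + (i == s + m.+1)%N%:R) / m.+1%:R.
Proof.
have m0 : (0 : R) < m.+1%:R by rewrite ltr0n.
rewrite /ramp mulrA -mulNr -!mulrDl normrM [`|_^-1|]gtr0_norm ?invr_gt0 //.
congr (_ / _).
have [->|is_] := eqVneq i s; last have [->|ism] := eqVneq i (s + m.+1)%N.
- rewrite (_ : s == s + m.+1 = false)%N; last by lia.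
  rewrite (_ : minn (s.+1 - s) m.+1 = 1)%N; last by lia.
  rewrite (_ : minn (s - s) m.+1 = 0)%N; last by lia.
  rewrite (_ : minn (s.-1 - s) m.+1 = 0)%N; last by lia.
  by rewrite mulr0 oppr0 !addr0 normr1.
- rewrite (_ : minn ((s + m.+1).+1 - s) m.+1 = m.+1)%N; last by lia.
  rewrite (_ : minn (s + m.+1 - s) m.+1 = m.+1)%N; last by lia.
  rewrite (_ : minn ((s + m.+1).-1 - s) m.+1 = m)%N; last by lia.
  rewrite (_ : _ - _ + _ = -1); last by rewrite -natr1; ring.
  by rewrite normrN1 add0r.
- have [lt_is|le_si] := ltnP i s.
    rewrite (_ : minn (i.+1 - s) m.+1 = 0)%N; last by lia.
    rewrite (_ : minn (i - s) m.+1 = 0)%N; last by lia.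
    rewrite (_ : minn (i.-1 - s) m.+1 = 0)%N; last by lia.
    by rewrite mulr0 oppr0 !addr0 normr0.
  have [lt_i|le_i] := ltnP i (s + m.+1).
    rewrite (_ : minn (i.+1 - s) m.+1 = (i.-1 - s).+2)%N; last by lia.
    rewrite (_ : minn (i - s) m.+1 = (i.-1 - s).+1)%N; last by lia.
    rewrite (_ : minn (i.-1 - s) m.+1 = (i.-1 - s))%N; last by lia.
    rewrite (_ : _ - _ + _ = 0); last by rewrite -!natr1; ring.
    by rewrite normr0 addr0.
  rewrite (_ : minn (i.+1 - s) m.+1 = m.+1)%N; last by lia.
  rewrite (_ : minn (i - s) m.+1 = m.+1)%N; last by lia.
  rewrite (_ : minn (i.-1 - s) m.+1 = m.+1)%N; last by lia.
  rewrite (_ : _ - _ + _ = 0); last by ring.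
  by rewrite normr0 addr0.
Qed.

Lemma L_block (R : realType) (rho : R) (n s m : nat) : (s + m <= n)%N ->
  L rho (beta_block R n s m) =
    (rho ^+ (n.+1 - s) + rho ^+ (n - (s + m))) / m.+1%:R.
Proof.
move=> smn; rewrite L_nat.
under eq_bigr do rewrite !Bprod_block // ramp_second_diff mulrAC mulrDl.
rewrite -mulr_suml big_split /=; congr (_ / _).
have pick k : (k < n.+2)%N ->
    \sum_(i < n.+2) (i == k :> nat)%:R * rho ^+ (n.+1 - i) = rho ^+ (n.+1 - k).
  move=> kn; rewrite (bigD1 (Ordinal kn)) //= eqxx mul1r big1 ?addr0 //.
  by move=> i; rewrite -val_eqE /= => /negbTE ->; rewrite mul0r.
by rewrite !pick ?addnS ?subSS //; lia.
Qed.

(** Once the ramp is saturated its successive ratios are 1, which are the trailing weights of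
    [beta_opt]; if [n <= n0], saturation comes only at index n+1. *)
Lemma beta_optE (R : realType) (n n0 : nat) :
  beta_opt R n n0 = beta_block R n 0 (minn n0 n).
Proof.
apply/rowP => j; rewrite !mxE !subn0; have jn := ltn_ord j; case: ltnP => jn0.
  rewrite (_ : minn j.+1 _ = j.+1)%N; last by lia.
  by rewrite (_ : minn j.+2 _ = j.+2)%N //; lia.
rewrite (_ : minn j.+1 _ = (minn n0 n).+1)%N; last by lia.
rewrite (_ : minn j.+2 _ = (minn n0 n).+1)%N; last by lia.
by rewrite divff ?pnatr_eq0.
Qed.

Lemma beta_halpernE (R : realType) (n : nat) :
  beta_halpern R n = beta_block R n 0 n.
Proof.
apply/rowP => j; rewrite !mxE !subn0; have jn := ltn_ord j.
by rewrite !(minn_idPl _) //; lia.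
Qed.

Lemma L_halpern (R : realType) (rho : R) (n : nat) :
  L rho (beta_halpern R n) = (1 + rho ^+ n.+1) / n.+1%:R.
Proof. by rewrite beta_halpernE L_block // subn0 subnn addrC. Qed.

Lemma minimizer_is_Lstar (R : realType) (rho : R) (n : nat) (beta : 'rV[R]_n) :
  L_minimizer rho beta -> is_Lstar rho n (L rho beta).
Proof.
move=> [cbeta le_beta]; split; first by exists beta.
by move=> _ [beta' cbeta' <-]; apply: le_beta.
Qed.

(** * Unimodality of the mean weight and the threshold [n0] *)

Lemma unimodal_min (R : realType) (g : nat -> R) (n0 : nat) :
  (forall k, (k < n0)%N -> g k.+1 <= g k) ->
  (forall k, (n0 <= k)%N -> g k <= g k.+1) ->
  forall n k, (k <= n)%N -> g (minn n0 n) <= g k.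
Proof.
move=> gdec ginc n k kn.
have dec d j : (j + d <= n0)%N -> g (j + d)%N <= g j.
  elim: d => [|d IHd] jd; first by rewrite addn0.
  by rewrite addnS; apply: le_trans (gdec _ _) (IHd _); lia.
have inc d : g n0 <= g (n0 + d)%N.
  elim: d => [|d IHd]; first by rewrite addn0.
  by rewrite addnS; apply: le_trans IHd (ginc _ _); lia.
have [n0k|kn0] := leqP n0 k.
  have -> : minn n0 n = n0 by lia.
  by have := inc (k - n0)%N; rewrite subnKC.
have le_k : (k <= minn n0 n)%N by lia.
by have := dec (minn n0 n - k)%N k; rewrite subnKC //; apply; apply: geq_minl.
Qed.

Definition mean_weight {R : realType} (sigma : R) (k : nat) : R :=
  (1 + sigma ^+ k) / k%:R.

(** What remains after clearing denominators when the mean weights at k+1 and k are compared: the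
    decrease amounts to [excess sigma k <= 1]. *)
Definition excess {R : realType} (sigma : R) (k : nat) : R :=
  sigma ^+ k * (k%:R * sigma - k.+1%:R).

Lemma mean_weight_le (R : realType) (sigma : R) (k : nat) :
  (mean_weight sigma k.+2 <= mean_weight sigma k.+1) =
  (excess sigma k.+1 <= 1).
Proof.
rewrite /mean_weight /excess ler_pdivrMr ?ltr0n // mulrAC ler_pdivlMr ?ltr0n //.
rewrite -subr_ge0 -[RHS]subr_ge0 [sigma ^+ k.+2]exprS -[k.+2%:R]natr1.
by congr (0 <= _); ring.
Qed.

(** Consecutive values differ by a nonnegative multiple of the square of [sigma - 1]. Hence the
    indices with excess at most 1 form an initial segment. *)
Lemma excess_incr (R : realType) (sigma : R) (i j : nat) :
  0 <= sigma -> (i <= j)%N -> excess sigma i <= excess sigma j.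
Proof.
move=> s0 /subnKC <-; elim: (j - i)%N => [|d IHd]; first by rewrite addn0.
rewrite addnS; apply: le_trans IHd _; rewrite -subr_ge0 /excess.
have -> : forall k, sigma ^+ k.+1 * (k.+1%:R * sigma - k.+2%:R) -
    sigma ^+ k * (k%:R * sigma - k.+1%:R) =
    k.+1%:R * sigma ^+ k * (sigma - 1) ^+ 2.
  by move=> k; rewrite exprS -[k.+2%:R]natr1 -[k.+1%:R]natr1; ring.
by rewrite mulr_ge0 ?sqr_ge0 // mulr_ge0 ?exprn_ge0.
Qed.

Lemma expansion_indicesE (R : realType) (sigma : R) (k : nat) :
  0 <= sigma -> expansion_indices sigma k <-> excess sigma k <= 1.
Proof.
move=> s0; case: k => [|k]; rewrite /expansion_indices /=.
  (* The excess at 0 is -1, so the convention for [k = 0] agrees with the criterion. *)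
  by split=> [_|]; [rewrite /excess; lra | left].
rewrite -/(mean_weight sigma k.+2) -/(mean_weight sigma k.+1).
by rewrite mean_weight_le; split=> [[]|] //; right.
Qed.

Lemma expansion_max (R : realType) (sigma : R) : 1 < sigma ->
  exists n0 : nat, is_max (expansion_indices sigma) n0 /\
    forall n k, (k <= n)%N ->
      mean_weight sigma (minn n0 n).+1 <= mean_weight sigma k.+1.
Proof.
move=> s1; have s0 : 0 <= sigma by lra.
(* This gives N (sigma - 1) > 3, so the excess at [N] is sigma^N (N (sigma - 1) - 1) > 2, which
   bounds the index set. *)
pose N := Num.bound (3 / (sigma - 1)).
have excessN : 1 < excess sigma N.
  have : 3 / (sigma - 1) < N%:R.
    by apply: archi_boundP; rewrite divr_ge0 // subr_ge0 ltW.
  rewrite ltr_pdivrMr ?subr_gt0 // => N3.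
  have sN : 1 <= sigma ^+ N by rewrite exprn_ege1 // ltW.
  by rewrite /excess -natr1; nra.
have ex0 : exists i, (fun k => excess sigma k <= 1) i.
  by exists 0%N; rewrite /excess; lra.
have ub i : excess sigma i <= 1 -> (i <= N)%N.
  move=> ei; rewrite leqNgt; apply/negP => /ltnW/(excess_incr _ _ _ _ s0) Ni.
  by lra.
case: (ex_maxnP ex0 ub) => n0 en0 maxn0; exists n0; split.
  split; first exact/expansion_indicesE.
  by move=> k /(expansion_indicesE _ _ _ s0)/maxn0; rewrite leEnat.
apply: (unimodal_min _ (fun k => mean_weight sigma k.+1)) => k kn0.
  by rewrite mean_weight_le; apply: le_trans (excess_incr _ _ _ _ s0 kn0) en0.
(* From [n0] on the increase is strict: otherwise [k.+1] would be an index beyond the maximum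
   [n0]. *)
apply: ltW; rewrite ltNge mean_weight_le; apply/negP => /maxn0.
by rewrite leqNgt ltnS kn0.
Qed.

Lemma expr_mean_weightV (R : realType) (rho : R) (n k : nat) :
  rho != 0 -> (k <= n)%N ->
  rho ^+ n * mean_weight rho^-1 k = (rho ^+ n + rho ^+ (n - k)) / k%:R.
Proof.
move=> r0 kn; rewrite /mean_weight mulrA mulrDr mulr1 exprVn.
by rewrite -{2}(subnK kn) exprD mulfK ?expf_neq0.
Qed.

(** At a positive index k, multiplying the comparison for 1/rho by rho^(k+1) yields the one for
    [rho]; the contraction case thus inherits its threshold from the expansion case. *)
Lemma contraction_indicesE (R : realType) (rho : R) :
  0 < rho -> contraction_indices rho = expansion_indices rho^-1.
Proof.
move=> r0; apply/funext => -[|k]; apply/propext.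
  by split=> _; left.
rewrite /contraction_indices /expansion_indices /=.
rewrite -/(mean_weight rho^-1 k.+2) -/(mean_weight rho^-1 k.+1).
rewrite -[mean_weight _ _ <= _](ler_pM2l (exprn_gt0 k.+2 r0)).
rewrite !expr_mean_weightV ?gt_eqF //.
rewrite subnn subSnn expr0 expr1 mulrA mulrDr mulr1 -exprS.
by rewrite [rho ^+ k.+2 + 1]addrC [rho ^+ k.+2 + rho]addrC.
Qed.

Theorem theorem8 (R : realType) (rho : R) :
  (0 < rho < 1 ->
     exists n0 : nat,
       is_max (contraction_indices rho) n0 /\
       forall n : nat, (1 <= n)%N ->
         L_minimizer rho (beta_opt R n n0) /\
         is_Lstar rho n
           (if (n <= n0)%N then (1 + rho ^+ n.+1) / (n.+1)%:R
            else (1 + rho ^+ n0.+1) / (n0.+1)%:R * rho ^+ (n - n0))) /\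
  (1 < rho ->
     exists n0 : nat,
       is_max (expansion_indices rho) n0 /\
       forall n : nat, (1 <= n)%N ->
         ((n <= n0)%N -> L_minimizer rho (beta_halpern R n)) /\
         ((n0 < n)%N -> is_Lstar rho n (L rho (beta_halpern R n0))) /\
         is_Lstar rho n
           (if (n <= n0)%N then (1 + rho ^+ n.+1) / (n.+1)%:R
            else (1 + rho ^+ n0.+1) / (n0.+1)%:R)).
Proof.
split=> [/andP[r0 r1] | r1].
  have rn0 : rho != 0 by rewrite gt_eqF.
  have [|n0 [n0max n0min]] := expansion_max _ rho^-1; first by rewrite invf_gt1.
  exists n0; rewrite contraction_indicesE //; split=> // n _.
  have Lopt : L rho (beta_opt R n n0) =
      rho ^+ n.+1 * mean_weight rho^-1 (minn n0 n).+1.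
    rewrite beta_optE L_block ?geq_minr // subn0 expr_mean_weightV //.
    by rewrite ltnS geq_minr.
  have opt : L_minimizer rho (beta_opt R n n0).
    split=> [|beta _]; first by rewrite beta_optE; apply: beta_block_cube.
    rewrite Lopt; apply: L_ge_contraction; first by rewrite r0 ltW.
      rewrite mulr_ge0 ?exprn_ge0 ?divr_ge0 ?addr_ge0 ?exprn_ge0 ?invr_ge0 //;
        exact: ltW.
    (* Index 0 is trivial; at a positive index, dividing by it turns the certificate condition into
       minimality of the mean weight at [(minn n0 n).+1]. *)
    move=> [|i] i_n; first by rewrite mulr0 addr_ge0 ?exprn_ge0 // ltW.
    rewrite -ler_pdivlMr ?ltr0n // -expr_mean_weightV //.
    by rewrite ler_pM2l ?exprn_gt0 // n0min.
  split=> //; rewrite [X in is_Lstar _ _ X](_ : _ = L rho (beta_opt R n n0)).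
    exact: minimizer_is_Lstar.
  rewrite Lopt expr_mean_weightV ?ltnS ?geq_minr // subSS.
  case: leqP => n0n.
    by rewrite subnn addrC.
  have -> : rho ^+ n.+1 = rho ^+ n0.+1 * rho ^+ (n - n0).
    by rewrite -exprD addSn subnKC // ltnW.
  by ring.
have r0 : 0 <= rho by lra.
have [n0 [n0max n0min]] := expansion_max _ _ r1.
exists n0; split=> // n _.
(* The block ends at n+1. For [n0 < n] the first [n - n0] weights vanish, so the iterates wait at
   the starting point before [n0] Halpern steps; this realises the value of halting by a point of
   the cube. For [n <= n0] the truncated shift is 0. *)
have Lopt : L rho (beta_block R n (n - n0) (minn n0 n)) =
    mean_weight rho (minn n0 n).+1.
  rewrite L_block; last by lia.
  rewrite (_ : n.+1 - (n - n0) = (minn n0 n).+1)%N; last by lia.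
  by rewrite (_ : n - (n - n0 + minn n0 n) = 0)%N 1?addrC //; lia.
have opt : L_minimizer rho (beta_block R n (n - n0) (minn n0 n)).
  split=> [|beta _]; first exact: beta_block_cube.
  rewrite Lopt; apply: L_ge_expansion; first exact: ltW.
    by rewrite divr_ge0 // addr_ge0 // exprn_ge0.
  move=> [|i] i_n; first by rewrite mulr0 addr_ge0.
  by rewrite -ler_pdivlMr ?ltr0n // n0min.
have Lstar := minimizer_is_Lstar _ _ _ _ opt; rewrite Lopt in Lstar.
split=> [n_n0 | ].
  have n0n : (n - n0 = 0)%N by apply/eqP.
  by move: opt; rewrite n0n (minn_idPr n_n0) -beta_halpernE.
split=> [n0n|]; last by case: leqP Lstar.
by rewrite L_halpern; move: Lstar; rewrite (minn_idPl (ltnW n0n)).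
Qed.
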